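(* Let $(p,p')$ be a pair of coprime positive integers with $p\geq 2$, $p'\geq1$, and let $\varepsilon,\varepsilon'\in\{0,1\}$. For all $\lambda=(r,s;\theta),\ \lambda'=(r',s';\theta')\in\mathscr{S}_{p,p'}$ we have $$S_{\lambda,\lambda'}^{aa,(\varepsilon,\varepsilon')}=S_{\lambda',\lambda}^{aa,(\varepsilon',\varepsilon)}\qquad\text{and}\qquad \sum_{\lambda''\in\mathscr{S}_{p,p'}}S_{\lambda,\lambda''}^{aa,(\varepsilon,\varepsilon')}\,\overline{S_{\lambda'',\lambda'}^{aa,(\varepsilon',\varepsilon)}}=\delta_{\lambda,\lambda'}.$$
   Context: Put $a:=p'/p$. For $0\le m\le p-1$ let $\mathscr{S}^{(m)}_{p,p'}$ be the set of triples of integers $(r,s;\theta)$ with $1\le r\le p-1$, $0\le s\le p'-1$ and $2m+2p'-p=2(r-2\theta)p'-(2s+1)p$. Let $\mathscr{S}_{p,p'}:=\bigcup_{m=0}^{p-1}\mathscr{S}^{(m)}_{p,p'}$ (a finite set). For integers $r,r',s,s',\theta,\theta'$ and $\varepsilon,\varepsilon'\in\{0,1\}$, $$S_{(r,s;\theta),(r',s';\theta')}^{aa,(\varepsilon,\varepsilon')}:=i^{-\varepsilon\varepsilon'}(-1)^{(1-\varepsilon')s+(1-\varepsilon)s'}\frac{2}{p}\sin(\pi arr')\,e^{\pi ia(r-2\theta-1+\varepsilon)(r'-2\theta'-1+\varepsilon')}.$$ *)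

(* Defs.v *)
From HB Require Import structures.
From mathcomp Require Import all_boot all_order all_algebra.
From mathcomp Require Import all_classical all_reals all_analysis.
From mathcomp Require Export complex.
From mathcomp Require Import zify.

Set Implicit Arguments.
Unset Strict Implicit.
Unset Printing Implicit Defensive.

Import Order.TTheory GRing.Theory Num.Theory.

Local Open Scope classical_set_scope.
Local Open Scope ring_scope.

(* The triple (r, s; theta) is encoded as ((r, s), theta). *)
Definition triple : Type := (int * int * int)%type.

Definition Sset_at (p p' m : nat) : set triple :=
  [set l | let: (r, s, t) := l in
    [/\ 1 <= r <= p%:Z - 1,
        0 <= s <= p'%:Z - 1 &
        2 * m%:Z + 2 * p'%:Z - p%:Z
          = 2 * (r - 2 * t) * p'%:Z - (2 * s + 1) * p%:Z]].

Definition Sset (p p' : nat) : set triple :=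
  \bigcup_(m in [set m : nat | (m <= p - 1)%N]) Sset_at p p' m.

(* The sum \sum_(l \in A) is 0 by convention when the summand has infinite
   support in A; by this lemma that convention plays no role for
   A = Sset p p'. *)
Lemma finite_Sset (p p' : nat) : finite_set (Sset p p').
Proof.
apply: bigcup_finite => [|m /= mp].
  by apply: (sub_finite_set _ (finite_II p.+1)) => m /=; lia.
pose f (u : 'I_p * 'I_p' * 'I_(2 * p).+1) : triple :=
  ((u.1.1 : nat)%:Z, (u.1.2 : nat)%:Z, (u.2 : nat)%:Z - p%:Z).
apply: (@sub_finite_set _ _ (f @` setT)); last first.
  by apply: finite_image; exact: finite_finset.
move=> [[r s] t] /= [r1 s1 E].
have nE : (r - 2 * t - 1) * p'%:Z = m%:Z + s * p%:Z by lia.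
have n0 : 0 <= r - 2 * t - 1 by nia.
have np : r - 2 * t - 1 < p%:Z by nia.
have hr : (`|r| < p)%N by lia.
have hs : (`|s| < p')%N by lia.
have ht : (`|(t + p%:Z)%R| < (2 * p).+1)%N by lia.
exists (Ordinal hr, Ordinal hs, Ordinal ht) => //.
by rewrite /f /=; congr (_, _, _); lia.
Qed.

Section Smatrix.
Variable R : realType.

(* The complex number e^{i x}, for real x. *)
Definition expi (x : R) : R[i] := Complex (cos x) (sin x).

Definition Smatrix (p p' : nat) (e e' : 'I_2) (l l' : triple) : R[i] :=
  let a : R := p'%:R / p%:R in
  let: (r, s, t) := l in
  let: (r', s', t') := l' in
  'i%C ^ (- (e%:Z * e'%:Z))
  * (-1) ^ ((1 - e'%:Z) * s + (1 - e%:Z) * s')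
  * (2 / p%:R * sin (pi * a * r%:~R * r'%:~R))%:C%C
  * expi (pi * a * (r - 2 * t - 1 + e%:Z)%:~R
                 * (r' - 2 * t' - 1 + e'%:Z)%:~R).

End Smatrix.

(* Main.v *)
Require Import Defs.
From mathcomp Require Import all_boot all_order all_algebra.
From mathcomp Require Import all_classical all_reals all_analysis.
From mathcomp Require Import zify ring lra.
Import Order.TTheory GRing.Theory Num.Theory.
Local Open Scope classical_set_scope.
Local Open Scope ring_scope.

(** Put k := r - 2 theta - 1. The equation that defines the set of triples at
    level m reads k p' = s p + m, so m and s are the remainder and the quotient
    of k p' by p, and a triple is the same thing as a pair (r, k) with 0 < r < p,
    0 <= k < p and r + k odd ([SsetP], [sum_Sset]).

    Symmetry is visible on the formula. By symmetry, the product of two entries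
    in the sum is an entry in row lambda times the conjugate of an entry in row
    lambda', both in the column u := lambda''; the power of i cancels against
    its conjugate and the sign depending on u is squared. What remains
    ([Smatrix_mul_conj]) is a sum over the pairs (i, j) = (r'', k'') with
    i + j odd of
      sin(pi p' r i / p) sin(pi p' r' i / p) exp(pi i p' (k - k') (j + eps') / p).

    Writing the condition that i + j be odd as (1 - (-1)^i (-1)^j) / 2
    decouples the two variables: up to a factor, the sum is A_0 B_0 - A_1 B_1,
    where A_b is the sum of the products of sines and B_b the sum of the
    exponentials, both twisted by the signs (-1)^(b j). Since r + k and r' + k'
    are odd, the integers r + r' and k - k' have the same parity, and this makes
    one factor vanish in each unwanted case ([sum_odd_pairs]):
    - if p' (k - k') + b p is odd, A_b vanishes, because its terms change sign
      under i -> p - i ([sum_sine_eq0]);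
    - if it is even, B_b is a sum of powers of a p-th root of unity, so it
      vanishes unless 2 p divides p' (k - k') + b p ([sum_zeta]); as p' is prime
      to p and |k - k'| < p, this forces k = k' and b = 0.
    In the surviving case k = k', b = 0, one has B_0 = p, while A_0 is p / 2 or
    0 according as r = r' or not, by orthogonality of the sines
    ([sum_sine_orthogonal]). *)

(** * The exponential exp(i x) *)

Lemma expiD (R : realType) (x y : R) : expi (x + y) = expi x * expi y.
Proof.
rewrite /expi sinD cosD; congr Complex => //.
by rewrite addrC mulrC [X in _ + X]mulrC.
Qed.

Lemma expiN (R : realType) (x : R) : expi (- x) = (expi x)^*%C.
Proof. by rewrite /expi sinN cosN. Qed.

Lemma expi0 (R : realType) : expi (0 : R) = 1.
Proof. by rewrite /expi sin0 cos0. Qed.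

(** The half-angle formula cos x = 1 - 2 sin(x/2)^2 shows that the real part is
    below 1. *)
Lemma expi_neq1 (R : realType) (x : R) : 0 < x < 2 * pi -> expi x != 1.
Proof.
move=> /andP[x0 xpi]; apply/eqP => -[cx1 _].
move: cx1; apply/eqP; rewrite lt_eqF//.
have -> : x = (x / 2) *+ 2 by rewrite mulr2n; field.
have /sin_gt0_pi s0 : 0 < x / 2 < pi by apply/andP; split; lra.
by rewrite cos_mulr2n cos2sin2 mulr2n; nra.
Qed.

(** * Sums of 2p-th roots of unity and of sines *)

Section RootsOfUnity.
Variables (R : realType) (p : nat).
Hypothesis p_gt0 : (0 < p)%N.

Definition zeta (n : int) : R[i] := expi (pi * n%:~R / p%:R).
Definition sine (n : int) : R[i] := (sin (pi * n%:~R / p%:R))%:C%C.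

Let p_neq0 : p%:R != 0 :> R. Proof. by rewrite pnatr_eq0 -lt0n. Qed.

Lemma zetaD m n : zeta (m + n) = zeta m * zeta n.
Proof. by rewrite /zeta -expiD rmorphD /= mulrDr mulrDl. Qed.

Lemma zetaN n : zeta (- n) = (zeta n)^*%C.
Proof. by rewrite /zeta -expiN rmorphN /= mulrN mulNr. Qed.

Lemma zeta0 : zeta 0 = 1.
Proof. by rewrite /zeta mulr0 mul0r expi0. Qed.

Lemma zetaM n (j : nat) : zeta (n * j%:Z) = zeta n ^+ j.
Proof.
elim: j => [|j IH]; first by rewrite mulr0 zeta0 expr0.
by rewrite exprS -IH -zetaD; congr zeta; lia.
Qed.

Lemma zetap : zeta p%:Z = -1.
Proof.
rewrite /zeta mulfK// /expi cospi sinpi; apply/eqP.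
by rewrite eq_complex /= oppr0 !eqxx.
Qed.

(** These are the signs (-1)^n. Writing signs as values of [zeta] lets them be
    merged with the other exponentials through [zetaD]. *)
Lemma zetapM n : zeta (p%:Z * n) = if (2 %| n)%Z then 1 else -1.
Proof.
have nat_case (m : nat) : zeta (p%:Z * m%:Z) = if (2 %| m%:Z)%Z then 1 else -1.
  rewrite zetaM zetap -signr_odd; have -> : odd m = ~~ (2 %| m%:Z)%Z by lia.
  by case: (2 %| _)%Z; rewrite ?expr0 ?expr1.
have [n0|n0] := leP 0 n; first by have := nat_case `|n|%N; rewrite gez0_abs.
have := nat_case `|n|%N; rewrite ltz0_abs// mulrN zetaN.
move=> /(congr1 (@conjc R)); rewrite conjcK => ->.
have -> : (2 %| - n)%Z = (2 %| n)%Z by lia.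
by case: (2 %| _)%Z; rewrite ?rmorphN ?rmorph1.
Qed.

Lemma zeta_eq1 n : (zeta n == 1) = ((2 * p%:Z) %| n)%Z.
Proof.
have P0 : 2 * p%:Z != 0 by lia.
have [q [s [-> s0 sP]]] :
    exists q s : int, [/\ n = (p%:Z * (2 * q)) + s, 0 <= s & s < 2 * p%:Z].
  exists (divz n (2 * p%:Z)), (modz n (2 * p%:Z)); split.
  - by rewrite {1}(divz_eq n (2 * p%:Z)); congr (_ + _); ring.
  - exact: modz_ge0.
  - by have := ltz_mod n P0; lia.
have -> : ((2 * p%:Z) %| p%:Z * (2 * q) + s)%Z = (s == 0).
  have -> : p%:Z * (2 * q) + s = q * (2 * p%:Z) + s by ring.
  rewrite rpredDl; last exact/dvdz_mull/dvdzz.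
  apply/idP/eqP => [/dvdzP[c cs]|->]; last exact: dvdz0.
  by case: (leP c 0) => c0; nia.
have -> : zeta (p%:Z * (2 * q) + s) = zeta s.
  by rewrite zetaD zetapM dvdz_mulr ?dvdzz// mul1r.
have [->|s_neq0] := eqVneq s 0; first by rewrite zeta0 eqxx.
apply/negbTE/expi_neq1; apply/andP; split.
  by rewrite divr_gt0 ?mulr_gt0 ?pi_gt0 ?ltr0n ?ltr0z//; lia.
rewrite ltr_pdivrMr ?ltr0n// -mulrA [2 * _]mulrC -mulrA ltr_pM2l ?pi_gt0//.
have : s < p%:Z * 2 by lia.
by rewrite -(ltr_int R) rmorphM /=.
Qed.

(** For n even, zeta n is a p-th root of unity, so this is a geometric sum over
    a full period. *)
Lemma sum_zeta n : (2 %| n)%Z ->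
  \sum_(0 <= j < p) zeta (n * j%:Z) = if ((2 * p%:Z) %| n)%Z then p%:R else 0.
Proof.
move=> n_even; under eq_bigr do rewrite zetaM.
rewrite -zeta_eq1 big_mkord; have [->|z1] := eqVneq (zeta n) 1.
  by under eq_bigr do rewrite expr1n; rewrite sumr_const card_ord.
apply: (mulfI (x := zeta n - 1)); first by rewrite subr_eq0.
by rewrite -subrX1 mulr0 -zetaM mulrC zetapM n_even subrr.
Qed.

Lemma sineE n : sine n = (zeta n - zeta (- n)) / (2 * 'i%C).
Proof.
rewrite zetaN subcJ /= [_ * 'i%C]mulrAC [RHS]mulrAC divff ?mul1r //.
by rewrite mulf_neq0 ?pnatr_eq0// eq_complex /= oner_eq0 andbF.
Qed.

Lemma sine0 : sine 0 = 0.
Proof. by rewrite /sine mulr0 mul0r sin0. Qed.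

Lemma conj_sine n : (sine n)^*%C = sine n.
Proof. exact: conjc_real. Qed.

(** Substituting p - j for j in [sine (N * j)] changes it at most by a sign. *)
Lemma sine_reflection N n : sine (p%:Z * N - n) = - zeta (p%:Z * N) * sine n.
Proof.
have zz : zeta (- (p%:Z * N)) = zeta (p%:Z * N).
  by rewrite -mulrN !zetapM; have -> : (2 %| - N)%Z = (2 %| N)%Z by lia.
by rewrite !sineE opprB addrC (zetaD _ (- (_ * _))) zz zetaD; ring.
Qed.

Lemma mul_sine m n : sine m * sine n =
  (zeta (m - n) + zeta (n - m) - zeta (m + n) - zeta (- (m + n))) / 4.
Proof.
rewrite opprD !zetaD !sineE mulf_div.
have -> : 2 * 'i%C * (2 * 'i%C) = -4 :> R[i].
  by rewrite mulrACA -!expr2 sqr_i; ring.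
by rewrite invrN; ring.
Qed.

(** The substitution of p - j for j multiplies the j-th term by
    (-1)^(M + N + p b), which is -1 here, and the term j = 0 is zero. *)
Lemma sum_sine_eq0 b M N : ~~ (2 %| M + N + p%:Z * b)%Z ->
  \sum_(0 <= j < p) zeta (p%:Z * b * j%:Z) *
    (sine (M * j%:Z) * sine (N * j%:Z)) = 0.
Proof.
move=> odd_sum; rewrite big_ltn// !mulr0 sine0 !mulr0 add0r.
set S := \sum_(1 <= j < p) _.
suff : S = - S by move/eqP; rewrite -addr_eq0 -mulr2n mulrn_eq0 => /eqP.
rewrite {1}/S big_nat_rev /= -sumrN; apply: eq_big_nat => j /andP[j0 jp].
have -> : (1 + p - j.+1)%N%:Z = p%:Z - j%:Z by lia.
have reflect n : n * (p%:Z - j%:Z) = p%:Z * n - n * j%:Z by ring.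
rewrite !reflect !sine_reflection.
(* The factor split off is exp(pi i) to an exponent of the parity of p b, since
   the other summand of the exponent is even. *)
have -> : p%:Z * (p%:Z * b) - p%:Z * b * j%:Z =
          p%:Z * (p%:Z * b - 2 * b * j%:Z) + p%:Z * b * j%:Z by ring.
rewrite zetaD.
have -> : zeta (p%:Z * (p%:Z * b - 2 * b * j%:Z)) = zeta (p%:Z * (p%:Z * b)).
  by rewrite !zetapM; congr (if _ then _ else _); lia.
have : zeta (p%:Z * M) * zeta (p%:Z * N) * zeta (p%:Z * (p%:Z * b)) = -1.
  by rewrite -!zetaD -!mulrDr zetapM (negbTE odd_sum).
set x := zeta (p%:Z * M); set y := zeta (p%:Z * N); set z := zeta (p%:Z * _).
set u := zeta _; set v := sine _; set w := sine _ => xyz.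
have -> : z * u * (- x * v * (- y * w)) = (x * y * z) * (u * (v * w)) by ring.
by rewrite xyz mulN1r.
Qed.

(** A product of sines is a combination of exponentials of frequencies
    +- a (r - r') and +- a (r + r'), all even, which sum to p or to 0. The
    frequency a (r - r') is divisible by 2p only if r = r'. The frequency
    a (r + r') never is: p would divide r + r', so that r + r' = p; then a would
    be even, and so would p = r + r', against coprimality. *)
Lemma sum_sine_orthogonal (a r r' : int) :
  coprimez p a -> 0 < r < p%:Z -> 0 < r' < p%:Z -> (2 %| r - r')%Z ->
  \sum_(0 <= j < p) sine (a * r * j%:Z) * sine (a * r' * j%:Z) =
  if r == r' then p%:R / 2 else 0.
Proof.
move=> co_pa /andP[r_gt0 ltrp] /andP[r'_gt0 ltr'p] even_rr'.
have even_sum : (2 %| r + r')%Z by lia.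
have even_diff x : (2 %| x)%Z -> (2 %| a * x)%Z by exact: dvdz_mull.
have diffP : ((2 * p%:Z) %| a * (r - r'))%Z = (r == r').
  apply/idP/eqP => [|->]; last by rewrite subrr mulr0 dvdz0.
  move=> /(dvdz_trans (dvdz_mull 2 (dvdzz p%:Z))).
  rewrite Gauss_dvdzr// => /dvdzP[c].
  by have [c_lt0|c_gt0|->] := ltrgt0P c; nia.
have sumP : ((2 * p%:Z) %| a * (r + r'))%Z = false.
  apply/negP => dvd2p.
  have /dvdzP[c sum_eq] : (p%:Z %| r + r')%Z.
    rewrite -(Gauss_dvdzr _ co_pa).
    exact: dvdz_trans (dvdz_mull 2 (dvdzz p%:Z)) dvd2p.
  have c1 : c = 1 by nia.
  move: sum_eq dvd2p; rewrite c1 mul1r => sum_eq.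
  rewrite sum_eq dvdz_mul2r; last by lia.
  move=> even_a.
  have even_p : (2 %| p%:Z)%Z by lia.
  have : (2 %| gcdz p%:Z a)%Z by rewrite dvdz_gcd even_p.
  by rewrite (eqP co_pa).
have zeta_sum x : (2 %| x)%Z -> \sum_(0 <= j < p) zeta (- x * j%:Z) =
    \sum_(0 <= j < p) zeta (x * j%:Z).
  move=> x_even; rewrite !sum_zeta//; last by lia.
  by congr (if _ then _ else _); rewrite !dvdzE abszN.
transitivity ((\sum_(0 <= j < p) zeta (a * (r - r') * j%:Z)
  + \sum_(0 <= j < p) zeta (- (a * (r - r')) * j%:Z)
  - \sum_(0 <= j < p) zeta (a * (r + r') * j%:Z)
  - \sum_(0 <= j < p) zeta (- (a * (r + r')) * j%:Z)) / 4 : R[i]).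
  rewrite -big_split -!sumrB mulr_suml; apply: eq_bigr => j _.
  by rewrite mul_sine; congr ((zeta _ + zeta _ - zeta _ - zeta _) / 4); ring.
rewrite !zeta_sum ?even_diff// !sum_zeta ?even_diff// diffP sumP.
by case: eqP => _; field.
Qed.

(** The orthogonality relation behind the theorem, with a = p', c = eps'. Below,
    [A b] and [B b] are the one-variable sums twisted by the signs (-1)^(b j);
    the parity conditions on r + k and r' + k' ensure that at least one of them
    vanishes unless b = 0 and k = k'. *)
Lemma sum_odd_pairs (a c r r' k k' : int) :
  coprimez p a -> 0 < r < p%:Z -> 0 < r' < p%:Z ->
  0 <= k < p%:Z -> 0 <= k' < p%:Z ->
  ~~ (2 %| r + k)%Z -> ~~ (2 %| r' + k')%Z ->
  \sum_(1 <= i < p) \sum_(0 <= j < p | odd (i + j))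
     sine (a * r * i%:Z) * sine (a * r' * i%:Z) * zeta (a * (k - k') * (j%:Z + c))
  = if (r == r') && (k == k') then p%:R ^+ 2 / 4 else 0.
Proof.
move=> co_pa hr hr' hk hk' odd_rk odd_rk'.
pose A b : R[i] := \sum_(1 <= i < p) zeta (p%:Z * b * i%:Z) *
  (sine (a * r * i%:Z) * sine (a * r' * i%:Z)).
pose B b : R[i] := \sum_(0 <= j < p) zeta ((a * (k - k') + p%:Z * b) * j%:Z).
have A_full b : A b = \sum_(0 <= i < p) zeta (p%:Z * b * i%:Z) *
    (sine (a * r * i%:Z) * sine (a * r' * i%:Z)).
  by rewrite [RHS]big_ltn// !mulr0 sine0 !mulr0 add0r.
have split_parity : \sum_(1 <= i < p) \sum_(0 <= j < p | odd (i + j))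
     sine (a * r * i%:Z) * sine (a * r' * i%:Z) * zeta (a * (k - k') * (j%:Z + c))
  = zeta (a * (k - k') * c) / 2 * (A 0 * B 0 - A 1 * B 1).
  rewrite !mulr_suml -sumrB mulr_sumr; apply: eq_bigr => i _.
  rewrite !mulr_sumr -sumrB mulr_sumr big_mkcond; apply: eq_bigr => j _.
  rewrite !mulr0 mul0r zeta0 addr0 mulr1 (mulrDl _ p%:Z) mulrDr !zetaD.
  have parity : zeta (p%:Z * i%:Z) * zeta (p%:Z * j%:Z) =
      if odd (i + j) then -1 else 1.
    by rewrite -zetaD -mulrDr zetapM; case: ifP; case: ifP => //; lia.
  set v := sine _ * sine _; set y := zeta (p%:Z * i%:Z) in parity *.
  set z := zeta (p%:Z * j%:Z) in parity *; set u := zeta _; set w := zeta _.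
  have -> : w / 2 * (1 * v * u - y * v * (u * z)) =
            w / 2 * v * u * (1 - y * z) by ring.
  by rewrite parity; case: ifP => _; field.
have AB0 b : (b != 0) || (k != k') -> b \in [:: 0; 1] -> A b * B b = 0.
  move=> nz b01.
  have [even_n|odd_n] := boolP (2 %| a * (k - k') + p%:Z * b)%Z; last first.
    rewrite A_full sum_sine_eq0 ?mul0r//; apply: contra odd_n => even_n.
    (* r + r' and k - k' have the same parity. *)
    have -> : a * (k - k') + p%:Z * b =
      a * r + a * r' + p%:Z * b + a * (k - k' - r - r') by ring.
    by rewrite rpredD//; apply: dvdz_mull; lia.
  rewrite /B sum_zeta//; case: ifP; rewrite ?mulr0// => dvd2p.
  have /dvdzP[q kk'] : (p%:Z %| k - k')%Z.
    rewrite -(Gauss_dvdzr _ co_pa).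
    have := dvdz_trans (dvdz_mull 2 (dvdzz p%:Z)) dvd2p.
    by rewrite rpredDr// dvdz_mulr.
  (* |k - k'| < p *)
  have q0 : q = 0 by nia.
  have kk'_eq : k = k' by lia.
  move: nz dvd2p; rewrite kk'_eq eqxx orbF subrr mulr0 add0r.
  rewrite (mulrC 2) dvdz_mul2l; last by lia.
  by move: b01; rewrite !inE => /orP[] /eqP ->.
rewrite split_parity (AB0 1)// subr0.
have [kk'|kk'] := eqVneq k k'; last by rewrite AB0 ?kk' ?orbT// mulr0 andbF.
rewrite kk' subrr mulr0 mul0r zeta0 andbT.
have -> : B 0 = p%:R.
  by rewrite /B kk' subrr !mulr0 addr0 sum_zeta ?dvdz0.
have -> : A 0 = if r == r' then p%:R / 2 else 0.
  rewrite A_full -(@sum_sine_orthogonal a)//; last by lia.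
  by apply: eq_bigr => i _; rewrite mulr0 mul0r zeta0 mul1r.
by case: eqP => _; field.
Qed.
End RootsOfUnity.

(** * Triples as pairs (r, k) *)

(** The integer k of a triple, in terms of which the level m is given by
    k p' = s p + m. *)
Definition height (l : triple) : int := let: (r, s, t) := l in r - 2 * t - 1.

(** The triple with r = i and k = j; the division by 2 is exact only when i + j
    is odd. *)
Definition triple_of (p p' i j : nat) : triple :=
  (i%:Z, (j * p' %/ p)%N%:Z, ((i%:Z - j%:Z - 1) %/ 2)%Z).

(** The equation k p' = s p + m with 0 <= m < p is the Euclidean division of
    k p' by p, which leaves r and k free; the bounds on s and those on k
    correspond to each other. *)
Lemma SsetP (p p' : nat) (l : triple) : (0 < p)%N -> (0 < p')%N ->
  Sset p p' l <-> [/\ 0 < l.1.1 < p%:Z, 0 <= height l < p%:Z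
    & l.1.2 = (height l * p'%:Z %/ p%:Z)%Z].
Proof.
case: l => [[r s] t] p_gt0 p'_gt0 /=; set k := r - 2 * t - 1; split.
  move=> [m /= m_le [r_range s_range level]].
  have kE : k * p'%:Z = s * p%:Z + m%:Z by rewrite /k; lia.
  have m_small : (m%:Z %/ p%:Z)%Z = 0 by apply: divz_small; lia.
  have p'Z_gt0 : 0 < p'%:Z by lia.
  split; first by lia.
    rewrite -(pmulr_lge0 k p'Z_gt0) -(ltr_pM2r p'Z_gt0) kE.
    have sp : 0 <= s * p%:Z <= (p'%:Z - 1) * p%:Z.
      by case/andP: s_range => s_ge0 s_le; rewrite mulr_ge0// ler_wpM2r.
    by lia.
  by rewrite kE divzMDl ?m_small ?addr0//; lia.
move=> [r_range k_range sE].
have p_neq0 : p%:Z != 0 by lia.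
have rem_ge0 := modz_ge0 (k * p'%:Z) p_neq0.
have rem_lt := ltz_mod (k * p'%:Z) p_neq0.
have kE := divz_eq (k * p'%:Z) p%:Z; rewrite -sE in kE.
set m := modz _ _ in rem_ge0 rem_lt kE.
by exists `|m|%N; rewrite /=; [lia | split; [lia | nia | rewrite /k in kE; lia]].
Qed.

Lemma height_triple_of (p p' i j : nat) : odd (i + j) ->
  height (triple_of p p' i j) = j%:Z.
Proof. by rewrite /height /triple_of; lia. Qed.

Lemma triple_of_bij (p p' : nat) : (0 < p)%N -> (0 < p')%N ->
  set_bij [set` (fun u : 'I_p * 'I_p => (0 < u.1)%N && odd (u.1 + u.2))]
    (Sset p p') (fun u => triple_of p p' u.1 u.2).
Proof.
move=> p_gt0 p'_gt0; split.
- move=> [i j] /= /andP[/= i_gt0 odd_ij].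
  have := ltn_ord i; have := ltn_ord j => ltjp ltip.
  apply/SsetP => //; rewrite height_triple_of// /triple_of /=.
  by split; [lia | lia | rewrite -PoszM divz_nat].
- move=> [i j] [i' j']; rewrite !inE /=.
  move=> /andP[/= _ odd_ij] /andP[/= _ odd_ij'] eq_t.
  have := congr1 height eq_t; rewrite !height_triple_of// => -[/val_inj ->].
  by case: eq_t => /val_inj ->.
- move=> [[r s] t] /(SsetP _ _ _ p_gt0 p'_gt0)[/= r_range k_range sE].
  have hr : (`|r| < p)%N by lia.
  have hk : (`|(r - 2 * t - 1)%R| < p)%N by lia.
  exists (Ordinal hr, Ordinal hk); first by apply/andP; split=> /=; lia.
  rewrite /triple_of sE /=; congr (_, _, _); [by lia | | by lia].
  by rewrite -divz_nat PoszM gez0_abs//; lia.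
Qed.

Lemma sum_Sset (V : nmodType) (p p' : nat) (F : triple -> V) :
  (0 < p)%N -> (0 < p')%N ->
  \sum_(l \in Sset p p') F l =
  \sum_(1 <= i < p) \sum_(0 <= j < p | odd (i + j)) F (triple_of p p' i j).
Proof.
move=> p_gt0 p'_gt0.
rewrite (reindex_fsbig _ _ _ F (triple_of_bij _ _ p_gt0 p'_gt0)).
rewrite -(@bigfs _ _ _ _ (index_enum _)); first last.
- by move=> u _; rewrite mem_index_enum.
- exact: index_enum_uniq.
rewrite -(pair_big_dep (fun i : 'I_p => (0 < i)%N) (fun i j : 'I_p => odd (i + j))
  (fun i j => F (triple_of p p' i j))) /=.
rewrite -(big_mkord (fun i => (0 < i)%N)
  (fun i => \sum_(j < p | odd (i + j)) F (triple_of p p' i j))).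
rewrite big_ltn_cond//= big_nat_cond [RHS]big_nat_cond.
apply: eq_big => [i|i _]; first by case: i.
by rewrite -(big_mkord (fun j => odd (i + j)) (fun j => F (triple_of p p' i j))).
Qed.

(** * The matrix S *)

Lemma exprzi_mul_conj (R : realType) (n : int) :
  'i%C ^ n * ('i%C ^ n)^*%C = 1 :> R[i].
Proof.
rewrite rmorphXz; last by rewrite unitfE eq_complex /= oner_eq0 andbF.
rewrite -expfzMl; have -> : ('i * 'i^*)%C = 1 :> R[i].
  by apply/eqP; rewrite eq_complex /=; apply/andP; split; apply/eqP; ring.
exact: exp1rz.
Qed.

Lemma sqr_signz (R : numFieldType) (n : int) : ((-1) ^ n) ^+ 2 = 1 :> R.
Proof. by rewrite expr2 -expfzMl mulrNN mulr1 exp1rz. Qed.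

(** The entries in terms of r and k only, up to the sign: theta enters through
    k = r - 2 theta - 1. *)
Lemma SmatrixE (R : realType) (p p' : nat) (e e' : 'I_2) (l l' : triple) :
  Smatrix R p p' e e' l l' =
  'i%C ^ (- (e%:Z * e'%:Z)) * (-1) ^ ((1 - e'%:Z) * l.1.2 + (1 - e%:Z) * l'.1.2)
  * (2 / p%:R * sine R p (p'%:Z * l.1.1 * l'.1.1))
  * zeta R p (p'%:Z * (height l + e%:Z) * (height l' + e'%:Z)).
Proof.
case: l l' => [[r s] t] [[r' s'] t'] /=.
rewrite /sine /zeta !rmorphM /= fmorphV !rmorph_nat.
by congr (_ * _ * (_ * (sin _)%:C%C) * expi _); rewrite !pmulrn; ring.
Qed.

Lemma Smatrix_sym (R : realType) (p p' : nat) (e e' : 'I_2) (l l' : triple) :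
  Smatrix R p p' e e' l l' = Smatrix R p p' e' e l' l.
Proof.
rewrite !SmatrixE.
by congr ('i%C ^ _ * (-1) ^ _ * (_ * sine _ _ _) * zeta _ _ _); ring.
Qed.

(** The two powers of i are conjugate to each other, and the sign depending on
    s'' occurs twice, so that u contributes only through its r and k. *)
Lemma Smatrix_mul_conj (R : realType) (p p' : nat) (e e' : 'I_2)
    (l l' u : triple) :
  Smatrix R p p' e e' l u * (Smatrix R p p' e' e u l')^*%C =
  (-1) ^ ((1 - e'%:Z) * (l.1.2 + l'.1.2)) * (4 / p%:R ^+ 2) *
  (sine R p (p'%:Z * l.1.1 * u.1.1) * sine R p (p'%:Z * l'.1.1 * u.1.1) *
   zeta R p (p'%:Z * (height l - height l') * (height u + e'%:Z))).
Proof.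
have conjcM (x y : R[i]) : (x * y)^*%C = x^*%C * y^*%C by exact: rmorphM.
have conj_sign k : ((-1) ^ k)^*%C = (-1) ^ k :> R[i].
  by rewrite fmorphXz /= oppr0.
rewrite (Smatrix_sym _ _ _ _ _ u) !SmatrixE 4!conjcM.
rewrite (conj_sign ((1 - e'%:Z) * l'.1.2 + (1 - e%:Z) * u.1.2)).
rewrite conj_sine -zetaN.
have -> : (2 / p%:R)^*%C = 2 / p%:R :> R[i].
  by rewrite conjcM conjc_inv !conjc_nat.
have -> : p'%:Z * (height l - height l') * (height u + e'%:Z) =
  p'%:Z * (height l + e%:Z) * (height u + e'%:Z)
  - p'%:Z * (height l' + e%:Z) * (height u + e'%:Z) by ring.
have -> : (1 - e'%:Z) * (l.1.2 + l'.1.2) =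
  (1 - e'%:Z) * l.1.2 + (1 - e'%:Z) * l'.1.2 by ring.
rewrite zetaD !expfzDr ?oppr_eq0 ?oner_eq0//.
have := exprzi_mul_conj R (- (e%:Z * e'%:Z)).
have := sqr_signz R[i] ((1 - e%:Z) * u.1.2).
set ic := _ ^*%C; set i := 'i%C ^ _; set g := (-1) ^ ((1 - e%:Z) * _).
set s := (-1) ^ _; set s' := (-1) ^ _; set v := sine _ _ _; set v' := sine _ _ _.
set z := zeta _ _ _; set z' := zeta _ _ _ => g2 iic.
have -> : forall q : R[i],
   i * (s * g) * (2 / q * v) * z * (ic * (s' * g) * (2 / q * v') * z')
   = i * ic * g ^+ 2 * (s * s' * (4 / q ^+ 2) * (v * v' * (z * z'))).
  by move=> q; rewrite -exprVn; ring.
by rewrite iic g2 !mul1r.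
Qed.

Theorem proposition4p16 (R : realType) (p p' : nat) (e e' : 'I_2)
    (hp : (2 <= p)%N) (hp' : (1 <= p')%N) (hpp' : coprime p p')
    (l l' : triple) (hl : l \in Sset p p') (hl' : l' \in Sset p p') :
  Smatrix R p p' e e' l l' = Smatrix R p p' e' e l' l /\
  \sum_(l'' \in Sset p p')
      Smatrix R p p' e e' l l'' * (Smatrix R p p' e' e l'' l')^*%C
    = (l == l')%:R.
Proof.
split; first exact: Smatrix_sym.
have p_gt0 : (0 < p)%N by lia.
move: hl hl'; rewrite !inE => /(SsetP _ _ _ p_gt0 hp')[r_range k_range sE].
move=> /(SsetP _ _ _ p_gt0 hp')[r'_range k'_range s'E].
rewrite sum_Sset//.
under eq_bigr => i _.
  under eq_bigr => j odd_ij do rewrite Smatrix_mul_conj height_triple_of//.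
  rewrite -mulr_sumr; over.
rewrite -mulr_sumr.
rewrite [X in _ * X](_ : _ = if (l.1.1 == l'.1.1) && (height l == height l')
                             then p%:R ^+ 2 / 4 else 0); last first.
  have odd_height (u : triple) : ~~ (2 %| u.1.1 + height u)%Z.
    by case: u => [[r s] t] /=; lia.
  exact: sum_odd_pairs.
have -> : (l.1.1 == l'.1.1) && (height l == height l') = (l == l').
  apply/andP/eqP => [[/eqP rr' /eqP kk']|-> //].
  (* s is the quotient of k p' by p. *)
  have ss' : l.1.2 = l'.1.2 by rewrite sE s'E kk'.
  move: rr' ss' kk'; clear; case: l l' => [[r s] t] [[r' s'] t'] /= -> -> tt'.
  by congr (_, _); lia.
case: eqP => [->|_]; last by rewrite mulr0.
have -> : (1 - e'%:Z) * (l'.1.2 + l'.1.2) =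
          (1 - e'%:Z) * l'.1.2 + (1 - e'%:Z) * l'.1.2 by ring.
rewrite expfzDr ?oppr_eq0 ?oner_eq0// -expr2 sqr_signz mul1r.
by rewrite mulr1n; field; rewrite pnatr_eq0 -lt0n.
Qed.
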